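(* Let $a,b$ be real numbers with $0<a<b$ and let $q\ge1$. Then $$\left|\frac{1}{L(a,b)}-\frac{1}{H(a,b)}-\frac{1}{2A(a,b)}\right|$$ $$\le\frac{A(a,b)^{1-\frac1q}}{4\cdot 12^{1/q}}\left\{\bigl[b^{-2q}(2a+b)+a^{-2q}(4a+5b)\bigr]^{1/q}+\bigl[a^{-2q}(a+2b)+b^{-2q}(5a+4b)\bigr]^{1/q}\right\}.$$
   Context: For $0<a<b$: $A(a,b)=\frac{a+b}{2}$ (arithmetic mean), $H(a,b)=\frac{2ab}{a+b}$ (harmonic mean), $L(a,b)=\frac{b-a}{\ln b-\ln a}$ (logarithmic mean). *)

(* Defs.v *)
From mathcomp Require Import all_boot all_order all_algebra.
From mathcomp Require Import reals exp.

Set Implicit Arguments.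
Unset Strict Implicit.
Unset Printing Implicit Defensive.

Import Order.TTheory GRing.Theory Num.Theory.
Local Open Scope ring_scope.

Definition arithmetic_mean (R : realType) (a b : R) : R := (a + b) / 2.

Definition harmonic_mean (R : realType) (a b : R) : R := 2 * a * b / (a + b).

(* Only meaningful for distinct positive [a] and [b]: at [a = b] the formula
   gives 0 rather than the continuous extension. *)
Definition logarithmic_mean (R : realType) (a b : R) : R :=
  (b - a) / (ln b - ln a).

(* Main.v *)
(** The two brackets of the right-hand side are weighted power means of order
    [q] of [1/a^2] and [1/b^2]: the weights of each bracket add up to [6(a+b)].
    By convexity of [x |-> x^q] they only decrease when [q] is replaced by [1],
    where the bound becomes the rational function
    [((7a+5b)/b^2 + (5a+7b)/a^2) / 48].  For this bound the crude estimates
    [2/(a+b) <= 1/L(a,b) <= 1/a] suffice. *)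
Require Import Defs.
From mathcomp Require Import all_boot all_order all_algebra.
From mathcomp Require Import ring lra.
From mathcomp Require Import all_classical reals interval_inference.
From mathcomp Require Import normedtype derive convex exp hoelder.

Set Implicit Arguments.
Unset Strict Implicit.
Unset Printing Implicit Defensive.

Import Order.TTheory GRing.Theory Num.Theory.
Import numFieldNormedType.Exports.
Local Open Scope ring_scope.

(** Jensen's inequality for the convex map [x |-> x^q] with the normalised weights [u / (u + v)] and
    [v / (u + v)], followed by a [q]-th root. *)
Lemma weighted_mean_le_power_mean (R : realType) (u v x y q : R) :
  0 <= u -> 0 <= v -> 0 < u + v -> 0 <= x -> 0 <= y -> 1 <= q ->
  u * x + v * y
    <= (u + v) `^ (1 - 1 / q) * (u * x `^ q + v * y `^ q) `^ (1 / q).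
Proof.
move=> u0 v0 s0 x0 y0 q1; set s := u + v in s0 *.
have q0 : 0 < q by lra.
have t01 : 0 <= u / s <= 1.
  by rewrite divr_ge0 ?(ltW s0)//= ler_pdivrMr// mul1r lerDl.
have := @convex_powR R q q1 (Itv01 (andP t01).1 (andP t01).2) x y.
rewrite !inE/= !in_itv/= x0 y0 => /(_ isT isT).
rewrite convRE [X in X `^ _ <= _]convRE/=.
have -> : unstable.onem (u / s) = v / s.
  by rewrite /unstable.onem /s; field; rewrite gt_eqF.
rewrite (_ : u / s * x + v / s * y = (u * x + v * y) / s); last by ring.
rewrite (_ : u / s * _ + v / s * _ = (u * x `^ q + v * y `^ q) / s); last by ring.
set m := u * x + v * y; set p := u * _ + v * _ => mp.
have m0 : 0 <= m by rewrite addr_ge0 ?mulr_ge0.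
have p0 : 0 <= p by rewrite addr_ge0 ?mulr_ge0 ?powR_ge0.
have sV0 : 0 <= s^-1 by rewrite invr_ge0 ltW.
have /(ge0_ler_powR (r := 1 / q)) : 0 <= 1 / q by rewrite divr_ge0// ltW.
move=> /(_ _ _ _ _ mp); rewrite !nnegrE powR_ge0 mulr_ge0// => /(_ isT isT).
rewrite -powRrM mulrCA divff ?gt_eqF// mulr1 powRr1 ?mulr_ge0//.
rewrite ler_pdivrMr// => /le_trans; apply.
(* The normalising factor leaves the root as [s^(-1/q)]; together with the factor [s] cleared from
   the left it makes [s^(1 - 1/q)]. *)
rewrite powRM// -(powR_inv1 (ltW s0)) -powRrM mulN1r powRN.
rewrite powRB ?(gt_eqF s0) ?implybT// (powRr1 (ltW s0)).
by rewrite le_eqVlt; apply/orP; left; apply/eqP; ring.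
Qed.

(** The tangent bound [ln (1 + t) <= t] at [t = (b - a) / a]. *)
Lemma le_lnB (R : realType) (a b : R) :
  0 < a -> 0 < b -> ln b - ln a <= (b - a) / a.
Proof.
move=> a0 b0; rewrite -ln_div ?posrE//.
have ba0 : 0 < b / a by rewrite divr_gt0.
rewrite (_ : b / a = 1 + (b - a) / a); last by field; rewrite gt_eqF.
apply: le_ln1Dx; suff : (b - a) / a = b / a - 1 by lra.
by field; rewrite gt_eqF.
Qed.

Lemma ge_lnB (R : realType) (a b : R) :
  0 < a -> a <= b -> 2 * (b - a) / (a + b) <= ln b - ln a.
Proof.
move=> a0 ab.
(* Since [2 (x - a) / (a + x) = 2 - 4 a / (a + x)], this is [ln x - 2 (x - a) / (a + x)] up to a
   constant. Its derivative is [(x - a)^2 / (x (a + x)^2)], so [f a <= f b], which is the claim. *)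
pose f (x : R) := ln x + (4 * a) * (a + x)^-1.
pose df (x : R) := x^-1 - 4 * a / (a + x) ^+ 2.
have fdf (x : R) : 0 < x -> is_derive x (1 : R) f (df x).
  move=> x0; have ax : a + x != 0 by rewrite gt_eqF// addr_gt0.
  have lnx := is_derive1_ln x0.
  apply: is_derive_eq.
  rewrite /df /GRing.scale/=; field.
  by rewrite ax gt_eqF.
have [x xab] : exists2 x, x \in `[a, b] & f b - f a = df x * (b - a).
  apply: MVT_segment => // [x|]; last first.
    apply: derivable_within_continuous => x /[!in_itv]/= /andP[ax _].
    by have [] := fdf x (lt_le_trans a0 ax).
  by rewrite in_itv/= => /andP[ax _]; apply: fdf; apply: lt_trans ax.
have x0 : 0 < x by move: xab; rewrite in_itv/= => /andP[ax _]; lra.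
have : 0 <= df x * (b - a).
  apply: mulr_ge0; last by rewrite subr_ge0.
  rewrite (_ : df x = (x - a) ^+ 2 / (x * (a + x) ^+ 2)).
    by rewrite divr_ge0 ?sqr_ge0// mulr_ge0 ?sqr_ge0// ltW.
  by rewrite /df; field; rewrite !gt_eqF ?addr_gt0.
move=> /[swap] <-; rewrite /f => h.
suff : 2 * (b - a) / (a + b) = 4 * a * (a + a)^-1 - 4 * a * (a + b)^-1 by lra.
by field; rewrite !gt_eqF//; lra.
Qed.

Theorem proposition7 (R : realType) (a b q : R)
    (ha : 0 < a) (hab : a < b) (hq : 1 <= q) :
  `| 1 / logarithmic_mean a b - 1 / harmonic_mean a b
     - 1 / (2 * arithmetic_mean a b) |
  <= (arithmetic_mean a b) `^ (1 - 1 / q) / (4 * 12 `^ (1 / q))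
     * ((b `^ (- (2 * q)) * (2 * a + b)
           + a `^ (- (2 * q)) * (4 * a + 5 * b)) `^ (1 / q)
        + (a `^ (- (2 * q)) * (a + 2 * b)
           + b `^ (- (2 * q)) * (5 * a + 4 * b)) `^ (1 / q)).
Proof.
have b0 : 0 < b by lra.
have A0 : 0 < arithmetic_mean a b by rewrite /arithmetic_mean; lra.
have powV2 (x : R) : 0 < x -> x `^ (- (2 * q)) = (x ^- 2) `^ q.
  by move=> x0; rewrite -mulNr powRrM powR_invn// ltW.
have c12 : (12 : R) `^ (1 - 1 / q) = 12 / 12 `^ (1 / q).
  by rewrite powRB ?pnatr_eq0 ?implybT// powRr1// ler0n.
(* One bracket: the total weight [12 A] contributes [12^(1 - 1/q) = 12 / 12^(1/q)], and
   [12 / 48 = 1 / 4] gives the stated constant. *)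
have mean (u v x y : R) : 0 <= u -> 0 <= v -> 0 <= x -> 0 <= y ->
    u + v = 12 * arithmetic_mean a b ->
    (u * x + v * y) / 48 <= arithmetic_mean a b `^ (1 - 1 / q)
      / (4 * 12 `^ (1 / q)) * (x `^ q * u + y `^ q * v) `^ (1 / q).
  move=> u0 v0 x0 y0 uv.
  have uv0 : 0 < u + v by rewrite uv mulr_gt0// ltr0n.
  have := weighted_mean_le_power_mean u0 v0 uv0 x0 y0 hq.
  rewrite uv powRM ?ler0n ?(ltW A0)// c12 (mulrC u (_ `^ _)) (mulrC v (_ `^ _)).
  have : (12 : R) `^ (1 / q) != 0 by rewrite gt_eqF ?powR_gt0 ?ltr0n.
  set c := 12 `^ _; set A := arithmetic_mean a b `^ _; set P := (_ + _) `^ _ => cN0 h.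
  have -> : A / (4 * c) * P = 12 / c * A * P / 48 by field.
  by lra.
have aV0 : 0 <= a ^- 2 by rewrite invr_ge0 exprn_ge0// ltW.
have bV0 : 0 <= b ^- 2 by rewrite invr_ge0 exprn_ge0// ltW.
rewrite !powV2// mulrDr.
(* The exponent [q] disappears here: what remains to bound the left-hand side is the sum of the two
   linear means of [a^-2] and [b^-2]. *)
apply: le_trans (lerD (mean (2 * a + b) (4 * a + 5 * b) _ _ _ _ bV0 aV0 _)
                      (mean (a + 2 * b) (5 * a + 4 * b) _ _ _ _ aV0 bV0 _));
  try (rewrite /arithmetic_mean; lra).
have ba0 : 0 < b - a by lra.
set l := 1 / logarithmic_mean a b.
have lE : l = (ln b - ln a) / (b - a) by rewrite /l div1r invf_div.
have l_ge : 2 / (a + b) <= l.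
  by rewrite lE ler_pdivlMr// mulrAC ge_lnB// ltW.
have l_le : l <= 1 / a.
  by rewrite lE ler_pdivrMr// mulrC mul1r le_lnB.
have -> : 1 / harmonic_mean a b = (a + b) / (2 * a * b).
  by rewrite /harmonic_mean div1r invf_div.
have -> : 1 / (2 * arithmetic_mean a b) = 1 / (a + b).
  by rewrite /arithmetic_mean [2 * _]mulrC divfK ?pnatr_eq0.
set M := (X in _ <= X).
(* Up to a positive denominator, both differences are sums of squares in [a + b] and [b - a]. *)
have d0 : 0 < 48 * (a + b) * a ^+ 2 * b ^+ 2.
  by rewrite !mulr_gt0 ?exprn_gt0 ?ltr0n//; lra.
have lower : 0 <= M - ((a + b) / (2 * a * b) + 1 / (a + b) - 2 / (a + b)).
  have -> : M - ((a + b) / (2 * a * b) + 1 / (a + b) - 2 / (a + b))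
      = (4 * ((b - a) * (a + b)) ^+ 2 + 3 * ((b - a) ^+ 2) ^+ 2)
        / (48 * (a + b) * a ^+ 2 * b ^+ 2).
    by rewrite /M; field; rewrite !gt_eqF//; lra.
  by rewrite divr_ge0 ?(ltW d0)// addr_ge0// mulr_ge0 ?sqr_ge0 ?ler0n.
have upper : 0 <= M - (1 / a - (a + b) / (2 * a * b) - 1 / (a + b)).
  have -> : M - (1 / a - (a + b) / (2 * a * b) - 1 / (a + b))
      = (3 * (4 * a * b - (b - a) * (a + b)) ^+ 2
         + 3 * ((a + b) ^+ 2) ^+ 2 + ((b - a) * (a + b)) ^+ 2)
        / (48 * (a + b) * a ^+ 2 * b ^+ 2).
    by rewrite /M; field; rewrite !gt_eqF//; lra.
  by rewrite divr_ge0 ?(ltW d0)// !addr_ge0 ?sqr_ge0// mulr_ge0 ?sqr_ge0 ?ler0n.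
(* [l_ge] with [lower] bounds the difference below by [- M]; [l_le] with [upper] bounds it above by
   [M]. *)
by rewrite ler_norml; apply/andP; split; lra.
Qed.
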